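(* Let $(M,\Omega_1,\mu_1,p_1)$ be a $3$-integrable parametrized measure model and let $\kappa:\Omega_1\to\Omega_2$ be a statistic. If $\kappa$ is sufficient for the parameter $x\in M$, then the Amari-Chentsov structure transformed by $\kappa$ is equal to the original structure: the Fisher quadratic form and the Amari-Chentsov tensor of $(M,\Omega_2,\kappa_*(\mu_1),\kappa_*(p_1))$ coincide with the Fisher quadratic form and the Amari-Chentsov tensor of $(M,\Omega_1,\mu_1,p_1)$.
   Context: For a $\sigma$-finite non-negative measure $\mu$ on a measurable space $\Omega$, $\mathcal M_+(\Omega,\mu)=\{\phi\mu:\phi\in L^1(\Omega,\mu),\ \phi>0\}$ with the $L^1$-topology. For $k\ge1$, a $k$-integrable parametrized measure model $(M,\Omega,\mu,p)$ consists of a smooth (finite or infinite dimensional) Banach manifold $M$, a $\sigma$-finite reference measure $\mu$, and a continuous map $p:M\to\mathcal M_+(\Omega,\mu)$ for which there is a density potential $\bar p:M\times\Omega\to\mathbb{R}$, $p(x)=\bar p(x,\cdot)\mu$ for all $x$, such that: (i) for $\mu$-almost all $\omega$, $x\mapsto\ln\bar p(x,\omega)$ is defined and continuously Gâteaux-differentiable, i.e. $V\mapsto\partial_V\ln\bar p(x,\omega)$ is continuous on $TM$ and linear on each $T_xM$; (ii) for every continuous vector field $V$ on $M$, $\partial_V\ln\bar p(x,\cdot)\in L^k(\Omega,p(x))$ and $x\mapsto\|\partial_V\ln\bar p(x,\cdot)\|_{L^k(\Omega,p(x))}$ is continuous. The Amari-Chentsov structure of a $3$-integrable model is the pair consisting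 of the Fisher quadratic form $g^F(V,W)_x=\int_\Omega\partial_V\ln\bar p\,\partial_W\ln\bar p\,dp(x)$ and the Amari-Chentsov tensor $T^{AC}(V,W,X)_x=\int_\Omega\partial_V\ln\bar p\,\partial_W\ln\bar p\,\partial_X\ln\bar p\,dp(x)$. A statistic is a measurable map $\kappa:\Omega_1\to\Omega_2$; the transformed model $(M,\Omega_2,\kappa_*(\mu_1),\kappa_*(p_1))$ has density potential $\kappa_*(\bar p_1)=\frac{d\kappa_*(p_1)}{d\kappa_*(\mu_1)}$. The statistic $\kappa$ is sufficient for the parameter $x\in M$ if there are $s:M\times\Omega_2\to\mathbb{R}$ with $s(x,\cdot)\in L^1(\Omega_2,\kappa_*(\mu_1))$ for all $x$, and $t\in L^1(\Omega_1,\mu_1)$, such that for all $x\in M$, $\bar p_1(x,\omega_1)=s(x,\kappa(\omega_1))\,t(\omega_1)$ for $\mu_1$-a.e. $\omega_1$. *)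

(* Defs.v *)
From HB Require Import structures.
From mathcomp Require Import all_boot all_order all_algebra.
From mathcomp Require Import all_classical all_reals all_analysis.
Import Order.TTheory GRing.Theory Num.Theory.
Import numFieldNormedType.Exports.

Set Implicit Arguments.
Unset Strict Implicit.
Unset Printing Implicit Defensive.

Local Open Scope classical_set_scope.
Local Open Scope ring_scope.

(* C^oo in the Frechet sense. [D x [:: v_n; ...; v_1]] is the n-th derivative
   of f at x, a bounded multilinear form; linearity in the slots after the head
   follows from the last clause, which says that x |-> D^n f(x) is Frechet
   differentiable for the operator norm of multilinear maps. *)
Definition smooth_on (R : realType) (E F : normedModType R) (U : set E)
    (f : E -> F) : Prop :=
  exists D : E -> seq E -> F,
  [/\ forall x, U x -> D x [::] = f x,
      forall x vs, U x -> linear (fun v => D x (v :: vs)),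
      forall x n, U x -> exists C : R, forall vs : seq E, size vs = n ->
        `|D x vs| <= C * \prod_(v <- vs) `|v|
    & forall x n (e : R), U x -> 0 < e ->
        \forall h \near (0 : E), forall vs : seq E, size vs = n ->
          `|D (x + h) vs - D x vs - D x (h :: vs)|
            <= e * `|h| * \prod_(v <- vs) `|v|].

(* A smooth Banach manifold structure on the space M, given by an atlas. The
   charts may be modelled on different Banach spaces. [psi i] is the inverse of
   [phi i], with an arbitrary value outside [phi i @` dom i]. *)
Record banach_atlas (R : realType) (M : topologicalType) := BanachAtlas {
  idx : Type ;
  model : idx -> completeNormedModType R ;
  dom : idx -> set M ;
  phi : forall i, M -> model i ;
  psi : forall i, model i -> M ;
  dom_open : forall i, open (dom i) ;
  dom_cover : forall x, exists i, dom i x ;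
  phi_open : forall i, open (phi i @` dom i) ;
  phiK : forall i x, dom i x -> @psi i (phi i x) = x ;
  phi_continuous : forall i, {within dom i, continuous (phi i)} ;
  psi_continuous : forall i, {within phi i @` dom i, continuous (@psi i)} ;
  transition_smooth : forall i j,
    smooth_on (phi i @` (dom i `&` dom j)) (phi j \o @psi i) }.

Arguments model {R M b} i.
Arguments dom {R M b} i.
Arguments phi {R M b} i.
Arguments psi {R M b} i.

Section Manifold.
Context (R : realType) (M : topologicalType) (A : banach_atlas R M).

(* T_x M: families of local representatives, one for each chart around x,
   related by the differentials of the transition maps. Components at charts
   that do not contain x are 0, so that distinct families are distinct
   vectors. *)
Record tangent (x : M) := Tangent {
  rep : forall i : idx A, model i ;
  rep_out : forall i, ~ dom i x -> rep i = 0 ;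
  rep_compat : forall i j, dom i x -> dom j x ->
    rep j = 'd (phi j \o psi i) (phi i x) (rep i) }.

(* Continuity as a section of TM, whose topology is the one for which the
   bundle charts (x, V) |-> (phi i x, rep V i) are homeomorphisms. *)
Definition continuous_field (V : forall x, tangent x) : Prop :=
  forall i : idx A, {within dom i, continuous (fun x => rep (V x) i)}.

Definition chart_at (x : M) : idx A := sval (cid (dom_cover A x)).

(* partial_V f; by [rep_compat], it does not depend on the chart around x when
   f is continuously Gateaux-differentiable. *)
Definition tderive (f : M -> R) (x : M) (V : tangent x) : R :=
  'D_(rep V (chart_at x)) (f \o psi (chart_at x)) (phi (chart_at x) x).

(* Existence and linearity of V |-> partial_V f on each T_x M, and continuity
   on TM, in the bundle charts. *)
Definition C1_gateaux (f : M -> R) : Prop :=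
  forall i : idx A,
  [/\ forall u v : model i, (phi i @` dom i) u -> derivable (f \o psi i) u v,
      forall u : model i, (phi i @` dom i) u -> forall (a : R) (v w : model i),
        'D_(a *: v + w) (f \o psi i) u
          = a * 'D_v (f \o psi i) u + 'D_w (f \o psi i) u
    & {within (phi i @` dom i) `*` [set: model i],
        continuous (fun uv : model i * model i => 'D_(uv.2) (f \o psi i) uv.1)}].

Section Model.
Context d (O : measurableType d).
Implicit Types (mu nu : {measure set O -> \bar R}) (p : M -> {measure set O -> \bar R}).
Implicit Type pbar : M -> O -> R.

Definition has_density mu nu (h : O -> R) : Prop :=
  mu.-integrable setT (EFin \o h) /\
  forall B, measurable B -> nu B = (\int[mu]_(w in B) (h w)%:E)%E.

Definition Mplus mu : set {measure set O -> \bar R} :=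
  [set nu | exists2 h, has_density mu nu h & {ae mu, forall w, 0 < h w}].

Definition L1_continuous mu p : Prop :=
  forall x (e : R), 0 < e -> \forall y \near x, forall h k,
    has_density mu (p x) h -> has_density mu (p y) k ->
    ('N[mu]_1 [EFin \o (k \- h)%R] < e%:E)%E.

(* Membership of an almost everywhere defined function (a class) in L^k. *)
Definition in_Lk nu (k : R) (f : O -> R) : Prop :=
  exists2 g : O -> R, g \in Lfun nu k%:E & {ae nu, forall w, f w = g w}.

(* partial_V ln pbar (x, .) *)
Definition dlog pbar x (V : tangent x) (w : O) : R :=
  tderive (fun y => ln (pbar y w)) V.

(* The positivity in the second field says that ln pbar(x, w) is defined: the
   library's [ln] is 0 on nonpositive numbers. *)
Record density_potential mu p pbar : Prop := DensityPotential {
  dp_density : forall x, has_density mu (p x) (pbar x) ;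
  dp_regular : {ae mu, forall w, (forall x, 0 < pbar x w) /\
                                 C1_gateaux (fun x => ln (pbar x w))} }.

(* (M, O, mu, p) is a k-integrable parametrized measure model, with density
   potential pbar. *)
Record integrable_model (k : R) mu p pbar : Prop := IntegrableModel {
  im_sigma_finite : sigma_finite setT mu ;
  im_Mplus : forall x, Mplus mu (p x) ;
  im_continuous : L1_continuous mu p ;
  im_potential : density_potential mu p pbar ;
  im_Lk : forall V : (forall x, tangent x), continuous_field V ->
    forall x, in_Lk (p x) k (dlog pbar (V x)) ;
  im_norm_continuous : forall V : (forall x, tangent x), continuous_field V ->
    continuous (fun x => 'N[p x]_(k%:E) [EFin \o dlog pbar (V x)]%E) }.

Definition fisher p pbar x (V W : tangent x) : \bar R :=
  (\int[p x]_w (dlog pbar V w * dlog pbar W w)%:E)%E.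

Definition amari_chentsov p pbar x (V W X : tangent x) : \bar R :=
  (\int[p x]_w (dlog pbar V w * dlog pbar W w * dlog pbar X w)%:E)%E.

End Model.
End Manifold.

Section Statistic.
Context (R : realType) d1 d2 (O1 : measurableType d1) (O2 : measurableType d2).

(* [pushforward mu kappa] with its measure structure, which the library cannot
   infer as it needs a proof that kappa is measurable. *)
Definition image_measure (kappa : {mfun O1 >-> O2})
    (mu : {measure set O1 -> \bar R}) : {measure set O2 -> \bar R} :=
  measure_function_pushforward__canonical__measure_function_Measure mu
    (measurable_funPT kappa).

Definition sufficient (M : Type) (mu1 : {measure set O1 -> \bar R})
    (pbar1 : M -> O1 -> R) (kappa : {mfun O1 >-> O2}) : Prop :=
  exists (s : M -> O2 -> R) (t : O1 -> R),
  [/\ forall x, (image_measure kappa mu1).-integrable setT (EFin \o s x),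
      mu1.-integrable setT (EFin \o t)
    & forall x, {ae mu1, forall w, pbar1 x w = s x (kappa w) * t w}].

End Statistic.

(* Main.v *)
(** Fix x and y.  Sufficiency makes ln pbar1(y, .) - ln pbar1(x, .) equal to
    g o kappa with g = ln |s_y| - ln |s_x|.  Hence p1(y) = (e^g o kappa) p1(x),
    so that kappa_* p1(y) = e^g kappa_* p1(x), and since densities with respect
    to kappa_* mu1 are unique a.e., ln pbar2(y, .) - ln pbar2(x, .) = g a.e.
    (kappa_* mu1 need not be sigma-finite, which rules out Radon-Nikodym.)
    Taking for y the points of a sequence that approaches x in the direction of
    V, the difference quotients of ln pbar1 and of ln pbar2 o kappa agree off a
    single null set, hence so do the logarithmic derivatives, and the integrals
    are equal by change of variables. *)
Require Import Defs.
From mathcomp Require Import all_boot all_order all_algebra.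
From mathcomp Require Import all_classical all_reals all_analysis.
From mathcomp Require Import measurable_realfun.
Import Order.TTheory GRing.Theory Num.Theory.
Import numFieldNormedType.Exports.
Import HBNNSimple.
Local Open Scope classical_set_scope.
Local Open Scope ring_scope.

Set Implicit Arguments.
Unset Strict Implicit.

(** * Integrals without measurability, and change of density *)

Section integral.
Local Open Scope ereal_scope.
Context d (T : measurableType d) (R : realType).
Implicit Types (mu nu : {measure set T -> \bar R}) (f : T -> \bar R).

(* Needed for nonmeasurable [f]: outside the regular points, [dlog pbar V] is
   arbitrary. *)
Lemma integral_null_setC mu (N : set T) f : measurable N -> mu N = 0 ->
  \int[mu]_(x in ~` N) f x = \int[mu]_x f x.
Proof.
move=> mN N0.
have ge0_eq g : (forall x, 0 <= g x) ->
    \int[mu]_(x in ~` N) g x = \int[mu]_x g x.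
  move=> g0; rewrite integral_mkcond.
  have gN0 x : 0 <= (g \_ (~` N)) x by rewrite patchE; case: ifP.
  rewrite !ge0_integralTE//; apply/eqP; rewrite eq_le; apply/andP; split.
    apply: ereal_sup_le => _ [h hg <-]; exists h => //= x.
    by rewrite (le_trans (hg x))// patchE; case: ifP.
  apply: ge_ereal_sup => _ [h hg <-]; apply: ereal_sup_ubound.
  (* The integral of [g] is a supremum over simple functions below it, whether or not [g] is
     measurable. Cutting such an [h] off on [N] puts it below the restriction and keeps its
     integral. *)
  exists (proj_nnsfun h (measurableC mN)) => [x|].
    rewrite /= patchE mindicE; case: ifP => _; first by rewrite mulr1.
    by rewrite mulr0.
  rewrite -!integralT_nnsfun [RHS](ge0_negligible_integral mN)//; last 2 first.
  - exact/measurable_EFinP.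
  - by move=> x _; rewrite lee_fin.
  rewrite setTD [RHS]integral_mkcond; apply: eq_integral => x _.
  rewrite /= patchE mindicE; case: ifP => _; first by rewrite mulr1.
  by rewrite mulr0.
by rewrite integralE [RHS]integralE !ge0_eq.
Qed.

(** By linearity the identity on measurable sets extends to simple functions, and monotone
    convergence along [nnsfun_approx] carries it to [f]. *)
Lemma ge0_integral_density mu nu (h : T -> R) f :
  measurable_fun setT h -> (forall x, 0 <= h x)%R ->
  (forall B, measurable B -> nu B = \int[mu]_(x in B) (h x)%:E) ->
  measurable_fun setT f -> (forall x, 0 <= f x) ->
  \int[nu]_x f x = \int[mu]_x (f x * (h x)%:E).
Proof.
move=> mh h0 nuE mf f0.
have mEh : measurable_fun setT (EFin \o h) by exact/measurable_EFinP.
pose g := nnsfun_approx measurableT mf.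
have gf x : EFin (g n x) @[n --> \oo] --> f x by exact: cvg_nnsfun_approx.
have ndg x : nondecreasing_seq (fun n => (g n x)%:E).
  by move=> m n mn; rewrite lee_fin; exact/lefP/nd_nnsfun_approx.
have mg n : measurable_fun setT (EFin \o g n) by exact/measurable_EFinP.
have step n : \int[nu]_x (g n x)%:E = \int[mu]_x ((g n x)%:E * (h x)%:E).
  rewrite integralT_nnsfun sintegralE.
  transitivity (\int[mu]_x \sum_(y \in range (g n))
      (y * \1_(g n @^-1` [set y]) x)%:E * (h x)%:E).
    rewrite ge0_integral_fsum//=; last 2 first.
    - move=> y; apply: emeasurable_funM => //; apply/measurable_EFinP.
      exact: measurable_funM.
    - move=> y x _; apply: mule_ge0; first exact: nnfun_muleindic_ge0.
      by rewrite lee_fin.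
    apply: eq_fsbigr => y /[!inE] -[x _ <-].
    under [RHS]eq_integral do rewrite EFinM -muleA.
    rewrite ge0_integralZl_EFin//; last first.
    - by apply: emeasurable_funM => //; exact/measurable_EFinP.
    - by move=> z _; rewrite mule_ge0// lee_fin.
    rewrite nuE// integral_mkcond; congr (_ * _); apply: eq_integral => z _.
    by rewrite epatch_indic muleC.
  apply: eq_integral => x _.
  rewrite [in RHS]fimfunE -fsumEFin// ge0_mule_fsuml// => y.
  exact: nnfun_muleindic_ge0.
transitivity (limn (fun n => \int[nu]_x (g n x)%:E)).
  rewrite -monotone_convergence//.
  - by apply: eq_integral => x _; apply/esym/cvg_lim.
  - by move=> n x _; rewrite lee_fin.
under eq_fun do rewrite step.
rewrite -monotone_convergence//.
- apply: eq_integral => x _; apply/cvg_lim => //.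
  by apply: cvgeZr.
- by move=> n; apply: emeasurable_funM; [exact: mg|exact: mEh].
- by move=> n x _; rewrite mule_ge0// lee_fin.
- by move=> x _ m n mn; apply: lee_wpmul2r; [rewrite lee_fin|exact: ndg].
Qed.
End integral.

(** Countably many steps suffice to recover the derivative: null sets attached to the steps can be
    merged, and measurability passes to the limit. *)
Lemma derivable_cvg_seq (R : realType) (E : normedModType R) (f : E -> R)
    (u v : E) : derivable f u v ->
  (harmonic n)^-1 * (f (harmonic n *: v + u) - f u) @[n --> \oo] --> 'D_v f u.
Proof.
move=> /cvgr_dnbhsP /(_ harmonic); apply.
by split; [move=> n; rewrite invr_neq0|exact: cvg_harmonic].
Qed.

(** * Measures given by densities *)

Section integral_density.
Context d (T : measurableType d) (R : realType).
Implicit Types (mu nu : {measure set T -> \bar R}) (h : T -> R).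

Lemma has_density_measurable mu nu h : has_density mu nu h ->
  measurable_fun setT h.
Proof. by move=> [/integrableP[/measurable_EFinP]]. Qed.

Lemma has_density_null mu nu h N : has_density mu nu h -> measurable N ->
  mu N = 0%E -> nu N = 0%E.
Proof.
move=> dh mN N0; rewrite dh.2// null_set_integral//.
by apply/measurable_funTS/measurable_EFinP/(has_density_measurable dh).
Qed.

Lemma has_density_ae mu nu h (P : T -> Prop) : has_density mu nu h ->
  {ae mu, forall w, P w} -> {ae nu, forall w, P w}.
Proof.
move=> dh [N [mN N0 PN]]; exists N; split => //.
exact: has_density_null dh mN N0.
Qed.

(** Turns positivity almost everywhere into the nonnegativity everywhere that [ge0_integral_density]
    asks for. *)
Lemma has_density_norm mu nu h : has_density mu nu h ->
  {ae mu, forall w, 0 < h w} -> has_density mu nu (fun w => `|h w|).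
Proof.
move=> dh h0; have mh := has_density_measurable dh; split.
  exact: integrable_norm dh.1.
move=> B mB; rewrite dh.2//; apply: ae_eq_integral => //.
- exact/measurable_funTS/measurable_EFinP.
- exact/measurable_funTS/measurable_EFinP/measurableT_comp.
- by apply: filterS h0 => w /ltW /ger0_norm -> _.
Qed.

Lemma ge0_integral_has_density mu nu h (f : T -> R) B : has_density mu nu h ->
  {ae mu, forall w, 0 < h w} -> measurable B ->
  measurable_fun setT f -> (forall x, 0 <= f x) ->
  (\int[nu]_(x in B) (f x)%:E = \int[mu]_(x in B) (f x * `|h x|)%:E)%E.
Proof.
move=> dh /(has_density_norm dh) dnh mB mf f0.
rewrite integral_mkcond [RHS]integral_mkcond.
rewrite (ge0_integral_density (mu := mu) (has_density_measurable dnh))//;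
  last 3 first.
- exact: dnh.2.
- apply/(measurable_restrictT (EFin \o f) mB).
  exact/measurable_funTS/measurable_EFinP.
- by move=> x; rewrite patchE; case: ifP => // _; rewrite lee_fin.
apply: eq_integral => x _; rewrite !patchE; case: ifP => _ //=.
by rewrite mul0e.
Qed.

End integral_density.

(** * Image measures under a statistic *)

Section image.
Context (R : realType) d1 d2 (O1 : measurableType d1) (O2 : measurableType d2).
Variable kappa : {mfun O1 >-> O2}.
Implicit Types (mu nu : {measure set O1 -> \bar R}).

Lemma ae_image_measure mu (P : O2 -> Prop) :
  {ae image_measure kappa mu, forall w, P w} ->
  {ae mu, forall w, P (kappa w)}.
Proof.
move=> [N [mN N0 PN]]; exists (kappa @^-1` N); split => //.
  exact: measurable_funPTI.
by move=> w; exact: PN.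
Qed.

(** Change of variables is done off [N], where [f2] is measurable; then the preimage of [N] and the
    set where the integrands differ are discarded together, so [f1] may be nonmeasurable. *)
Lemma integral_image_measure mu (f2 : O2 -> \bar R) (f1 : O1 -> \bar R) N :
  measurable N -> image_measure kappa mu N = 0%E ->
  measurable_fun (~` N) f2 -> {ae mu, forall w, f2 (kappa w) = f1 w} ->
  (\int[image_measure kappa mu]_w f2 w = \int[mu]_w f1 w)%E.
Proof.
move=> mN N0 mf2 [N' [mN' N'0 f12]].
rewrite -(integral_null_setC _ mN N0).
have mkN : measurable (kappa @^-1` N) by exact: measurable_funPTI.
have mk : measurable_fun setT kappa by exact: measurable_funPT.
have mNc := measurableC mN.
rewrite integralE !(ge0_integral_pushforward mk)//; last 2 first.
- exact: measurable_funeneg.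
- exact: measurable_funepos.
have mN12 := measurableU _ _ mkN mN'.
have N120 : mu (kappa @^-1` N `|` N') = 0%E by rewrite measureU0.
transitivity (\int[mu]_(w in ~` (kappa @^-1` N)) f2 (kappa w))%E.
  rewrite [RHS]integralE; congr (_ - _)%E; apply: eq_integral => w _ /=;
    by rewrite ?funeposE ?funenegE.
rewrite (integral_null_setC _ mkN N0).
rewrite -(integral_null_setC _ mN12 N120).
rewrite -[RHS](integral_null_setC _ mN12 N120).
apply: eq_integral => w; rewrite inE setCU => -[_ /= N'w].
by apply: contrapT => /f12.
Qed.

(** An integrable density is determined almost everywhere by its integrals over measurable sets, so
    [ky] is compared with [expR \o g] times [kx] on each such set. *)
Lemma ln_density_image mu nux nuy (hx hy : O1 -> R) (kx ky : O2 -> R)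
    (g : O2 -> R) :
  has_density mu nux hx -> {ae mu, forall w, 0 < hx w} ->
  has_density mu nuy hy -> {ae mu, forall w, 0 < hy w} ->
  has_density (image_measure kappa mu) (image_measure kappa nux) kx ->
  {ae image_measure kappa mu, forall w, 0 < kx w} ->
  has_density (image_measure kappa mu) (image_measure kappa nuy) ky ->
  measurable_fun setT g ->
  {ae mu, forall w, ln (hy w) - ln (hx w) = g (kappa w)} ->
  {ae image_measure kappa mu, forall w, ln (ky w) - ln (kx w) = g w}.
Proof.
move=> dhx hx0 dhy hy0 dkx kx0 dky mg hg.
have mk : measurable_fun setT kappa by exact: measurable_funPT.
have meg : measurable_fun setT (expR \o g) by exact: measurableT_comp.
suff kyx : {ae image_measure kappa mu, forall w,
    ky w = expR (g w) * `|kx w|}.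
  move: kx0 kyx; apply: filterS2 => w kx0 ->.
  by rewrite gtr0_norm// lnM ?posrE ?expR_gt0// expRK addrK.
suff : ae_eq (image_measure kappa mu) setT (EFin \o ky)
    (fun w => (expR (g w) * `|kx w|)%:E).
  by apply: filterS => w /(_ Logic.I) [].
apply: integral_ae_eq => //.
- exact: dky.1.
- apply/measurable_EFinP; apply: measurable_funM => //.
  exact: measurableT_comp (has_density_measurable dkx).
(* Both integrals are the [nuy]-measure of the preimage of [B]: pulled back to the source, the right
   one has integrand [expR \o g \o kappa] times the absolute value of [hx], which is [hy] almost
   everywhere. *)
move=> B _ mB; rewrite -dky.2// -(ge0_integral_has_density dkx)//.
have mkB : measurable (kappa @^-1` B) by exact: measurable_funPTI.
rewrite (ge0_integral_pushforward mk)//; last first.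
  exact/measurable_funTS/measurable_EFinP.
rewrite /= (ge0_integral_has_density (f := expR \o g \o kappa) dhx hx0 mkB)//;
  last 2 first.
- exact: measurableT_comp.
- by move=> w; exact: expR_ge0.
rewrite /pushforward dhy.2//; apply: ae_eq_integral => //.
- exact/measurable_funTS/measurable_EFinP/(has_density_measurable dhy).
- apply/measurable_funTS/measurable_EFinP; apply: measurable_funM.
    exact: measurableT_comp.
  exact: measurableT_comp (has_density_measurable dhx).
apply: filterS3 hx0 hy0 hg => w hx0w hy0w gw _ /=.
by rewrite -gw expRB !lnK ?posrE// gtr0_norm// divfK// gt_eqF.
Qed.

End image.

(** * Logarithmic derivatives as limits of difference quotients *)

Section model.
Context (R : realType) (M : topologicalType) (A : banach_atlas R M).

(** The first terms may come from outside the chart image, where [psi] is arbitrary; limits see only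
    the tail. *)
Definition approach (x : M) (V : tangent A x) (n : nat) : M :=
  psi (chart_at A x)
    (harmonic n *: rep V (chart_at A x) + phi (chart_at A x) x).

Lemma tderive_cvg (f : M -> R) (x : M) (V : tangent A x) : C1_gateaux A f ->
  (harmonic n)^-1 * (f (approach V n) - f x) @[n --> \oo] --> tderive f V.
Proof.
move=> /(_ (chart_at A x)) [df _ _].
have xdom : dom (chart_at A x) x := svalP (cid (dom_cover A x)).
rewrite -{2}(phiK xdom).
by apply: derivable_cvg_seq; apply: df; exists x.
Qed.

Context d (O : measurableType d) (mu : {measure set O -> \bar R})
  (p : M -> {measure set O -> \bar R}) (pbar : M -> O -> R).
Hypothesis Dp : density_potential A mu p pbar.

Lemma density_potential_gt0 x : {ae mu, forall w, 0 < pbar x w}.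
Proof. by apply: filterS (dp_regular Dp) => w [/(_ x)]. Qed.

(** Off the null set of irregular points, which serves all [x] and [V] at once, [dlog pbar V] is a
    pointwise limit of measurable difference quotients. *)
Lemma measurable_dlog : exists N : set O, [/\ measurable N, mu N = 0%E &
  forall x (V : tangent A x), measurable_fun (~` N) (dlog pbar V)].
Proof.
have [N [mN N0 regN]] := dp_regular Dp.
exists N; split => // x V.
apply: (@measurable_fun_cvg _ _ _ _
  (fun n w => (harmonic n)^-1 * (ln (pbar (approach V n) w) - ln (pbar x w)))).
  have mln y : measurable_fun (~` N) (fun w => ln (pbar y w)).
    apply: measurable_funTS; apply: measurableT_comp => //.
    exact: has_density_measurable (dp_density Dp y).
  move=> n; apply: measurable_funM => //; exact: measurable_funB.
move=> w Nw; suff [_] : (forall x, 0 < pbar x w) /\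
    C1_gateaux A (fun x => ln (pbar x w)) by exact: tderive_cvg.
by apply: contrapT => /regN.
Qed.

End model.

(** * Consequences of sufficiency *)

Section sufficient.
Context (R : realType) (M : topologicalType) (A : banach_atlas R M).
Context d1 d2 (O1 : measurableType d1) (O2 : measurableType d2).
Variables (mu1 : {measure set O1 -> \bar R})
  (p1 : M -> {measure set O1 -> \bar R}) (pbar1 : M -> O1 -> R)
  (kappa : {mfun O1 >-> O2}) (pbar2 : M -> O2 -> R).
Hypothesis Dp1 : density_potential A mu1 p1 pbar1.
Hypothesis Dp2 : density_potential A (image_measure kappa mu1)
  (fun x => image_measure kappa (p1 x)) pbar2.
Hypothesis suff1 : sufficient mu1 pbar1 kappa.

Lemma sufficient_ln_ratio (x y : M) : {ae mu1, forall w,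
  ln (pbar2 y (kappa w)) - ln (pbar2 x (kappa w))
    = ln (pbar1 y w) - ln (pbar1 x w)}.
Proof.
have [s [t [is_ _ stE]]] := suff1.
(* Only the product of [s] and [t] is known to be positive, hence the absolute values; the term in
   [t] cancels in the difference. *)
pose g w2 := ln `|s y w2| - ln `|s x w2|.
have ms z : measurable_fun setT (fun w2 => ln `|s z w2|).
  apply: (measurableT_comp (@measurable_ln R)); apply: measurableT_comp => //.
  by case/integrableP: (is_ z) => /measurable_EFinP.
have mg : measurable_fun setT g by exact: measurable_funB.
have gE : {ae mu1, forall w, ln (pbar1 y w) - ln (pbar1 x w) = g (kappa w)}.
  apply: filterS (filterI (filterI (stE x) (stE y)) (filterI
    (density_potential_gt0 Dp1 x) (density_potential_gt0 Dp1 y))).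
  move=> w [[xE yE] [x0 y0]]; rewrite /g.
  have lnE z : pbar1 z w = s z (kappa w) * t w -> 0 < pbar1 z w ->
      ln (pbar1 z w) = ln `|s z (kappa w)| + ln `|t w|.
    move=> zE z0; rewrite -(gtr0_norm z0) zE normrM.
    by move: z0; rewrite zE => /lt0r_neq0; rewrite mulf_eq0 negb_or =>
      /andP[s0 t0]; rewrite lnM// posrE normr_gt0.
  by rewrite !lnE// opprD addrACA subrr addr0.
have := ln_density_image (dp_density Dp1 x) (density_potential_gt0 Dp1 x)
  (dp_density Dp1 y) (density_potential_gt0 Dp1 y) (dp_density Dp2 x)
  (density_potential_gt0 Dp2 x) (dp_density Dp2 y) mg gE.
by move=> /ae_image_measure; move: gE; apply: filterS2 => w -> ->.
Qed.

(* The equality of log-ratios holds off a null set that depends on the pair of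
   parameters; the derivatives need it only along one sequence. *)
Lemma sufficient_dlog (x : M) (V : tangent A x) :
  {ae mu1, forall w, dlog pbar2 V (kappa w) = dlog pbar1 V w}.
Proof.
have := ae_foralln (fun n => sufficient_ln_ratio x (approach V n)).
apply: filterS3 (dp_regular Dp1) (ae_image_measure (dp_regular Dp2)).
move=> w [_ C1] [_ C2] ratioE.
have := tderive_cvg (V := V) C2; under eq_cvg do rewrite ratioE.
by move=> /cvg_unique; apply => //; exact: tderive_cvg.
Qed.

(** Serves both tensors. Measurability of [f2] is asked relative to an arbitrary set because the
    exceptional null set is chosen inside the proof. *)
Lemma sufficient_integral x (f2 : O2 -> R) (f1 : O1 -> R) :
  (forall N, (forall y (V : tangent A y), measurable_fun N (dlog pbar2 V)) ->
    measurable_fun N f2) ->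
  {ae mu1, forall w, f2 (kappa w) = f1 w} ->
  (\int[image_measure kappa (p1 x)]_w (f2 w)%:E = \int[p1 x]_w (f1 w)%:E)%E.
Proof.
have [N [mN N0 mdlog]] := measurable_dlog Dp2.
move=> mf2 f21; apply: (integral_image_measure mN).
- exact: has_density_null (dp_density Dp2 x) mN N0.
- by apply/measurable_EFinP; exact: mf2.
- by apply: has_density_ae (dp_density Dp1 x) _; apply: filterS f21 => w ->.
Qed.

End sufficient.
Set Strict Implicit.
Unset Implicit Arguments.

Theorem theorem3p5 (R : realType) (M : topologicalType) (A : banach_atlas R M)
    (d1 d2 : measure_display)
    (O1 : measurableType d1) (O2 : measurableType d2)
    (mu1 : {measure set O1 -> \bar R}) (p1 : M -> {measure set O1 -> \bar R})
    (pbar1 : M -> O1 -> R) (kappa : {mfun O1 >-> O2}) (pbar2 : M -> O2 -> R) :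
  integrable_model A 3 mu1 p1 pbar1 ->
  sufficient mu1 pbar1 kappa ->
  density_potential A (image_measure kappa mu1)
    (fun x => image_measure kappa (p1 x)) pbar2 ->
  (forall (x : M) (V W : tangent A x),
     fisher (fun y => image_measure kappa (p1 y)) pbar2 V W
       = fisher p1 pbar1 V W) /\
  (forall (x : M) (V W X : tangent A x),
     amari_chentsov (fun y => image_measure kappa (p1 y)) pbar2 V W X
       = amari_chentsov p1 pbar1 V W X).
Proof.
move=> im suff1 Dp2; have Dp1 := im_potential im.
(* Products of logarithmic derivatives inherit measurability and almost everywhere equality from
   their factors. *)
split=> [x V W|x V W X]; apply: (sufficient_integral Dp1 Dp2).
- by move=> N mN; apply: measurable_funM.
- move: (sufficient_dlog Dp1 Dp2 suff1 V) (sufficient_dlog Dp1 Dp2 suff1 W).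
  by apply: filterS2 => w -> ->.
- by move=> N mN; do 2 ?[apply: measurable_funM].
- apply: filterS3 (sufficient_dlog Dp1 Dp2 suff1 V)
    (sufficient_dlog Dp1 Dp2 suff1 W) (sufficient_dlog Dp1 Dp2 suff1 X).
  by move=> w -> -> ->.
Qed.
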